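(* Consider the unit interval $\mathfrak{X}=[0,1]$ with its Euclidean metric $d$ and let $\mu$ be an absolutely continuous probability measure on $\mathfrak{X}$ with density $f$ satisfying $c\leq f(x)\leq C$ for every $x\in\mathfrak{X}$, where $0<c\leq C<\infty$. Given $\alpha\in(0,\infty)$ and $n\in\mathbb{N}$, let $$r(n)\equiv r(n,c,\alpha):=4c^{-1}\sqrt{(2+\alpha)\frac{\ln n}{n}}.$$ Then there exists $n_0\equiv n_0(c,C,\alpha)$, depending only on $c$, $C$, $\alpha$, such that $n\geq n_0$ implies that $(\mathfrak{X},d,\mu)$ is $(n,n^{-\alpha},r(n))$-disintegrable.
   Context: $\mathbb{N}=\{1,2,\dots\}$ and $[n]=\{1,\dots,n\}$. A metric Polish probability space $(\mathfrak{X},d,\mu)$ consists of a Polish space $\mathfrak{X}$, a (not necessarily complete) metric $d$ generating its topology, and a Borel probability measure $\mu$. $B(x,r)=\{y\in\mathfrak{X}: d(x,y)\leq r\}$ is the closed ball. Given $n\in\mathbb{N}$, $\epsilon>0$, $r>0$, $(\mathfrak{X},d,\mu)$ is $(n,\epsilon,r)$-disintegrable if, whenever $X_1,\dots,X_n$ are i.i.d. with distribution $\mu$ on a probability space $(\Psi,\mathcal{F},\mathbb{P})$, with $\mathbb{P}$-probability at least $1-\epsilon$ (i.e. on some event of probability at least $1-\epsilon$) there exists a disintegration of $\mu$ along the random multifunction $x\mapsto\{i\in[n]: x\in B(X_i,r)\}$ with respect to the uniform measure on $[n]$; that is, there exist Borel probability measures $\mu_1,\dots,\mu_n$ on $\mathfrak{X}$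 with $\mu_i(B(X_i,r))=1$ for all $i$ and $\mu=\frac1n\sum_{i=1}^n\mu_i$. *)

(* Defs.v *)
From HB Require Import structures.
From mathcomp Require Import all_boot all_order all_algebra.
From mathcomp Require Import all_classical all_reals all_analysis.
From mathcomp Require Import lra.

Set Implicit Arguments.
Unset Strict Implicit.
Unset Printing Implicit Defensive.

Import Order.TTheory GRing.Theory Num.Theory.
Import numFieldTopology.Exports numFieldNormedType.Exports.

Local Open Scope classical_set_scope.
Local Open Scope ring_scope.

Definition separable (T : topologicalType) : Prop :=
  exists2 D : set T, countable D & dense D.

Definition completely_metrizable (R : realType) (T : topologicalType) : Prop :=
  exists rho : T -> T -> R,
    [/\ forall x y, rho x y = 0 <-> x = y,
        forall x y, rho x y = rho y x,
        forall x y z, rho x z <= rho x y + rho y z,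
        forall A : set T, open A <->
          forall x, A x ->
            exists2 e : R, 0 < e & [set y | rho x y < e] `<=` A
      & forall u : nat -> T,
          (forall e : R, 0 < e ->
            exists N, forall m k, (N <= m)%N -> (N <= k)%N ->
              rho (u m) (u k) < e) ->
          exists l, forall e : R, 0 < e ->
            exists N, forall m, (N <= m)%N -> rho (u m) l < e].

(* The distance [mdist] of a metric Polish space is not assumed complete: only
   some metric generating the same topology is. The points (needed by
   [measurableType]) cost nothing, as only probability spaces matter here. *)
HB.mixin Record isPolish (R : realType) T & Metric R T := {
  polish_separable : separable T ;
  polish_completely_metrizable : completely_metrizable R T
}.

#[short(type="polishMetricType")]
HB.structure Definition PolishMetric (R : realType) :=
  {T of Pointed T & Metric R T & isPolish R T}.

Definition borel (R : realType) (T : polishMetricType R) :=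
  g_sigma_algebraType (@open T).

(* The library's [closed_ball] is the closure of the open ball, which may be
   smaller. *)
Definition metric_cball (R : realType) (T : polishMetricType R) (x : T)
  (r : R) : set T := [set y | mdist x y <= r].

Section disintegrable.
Context {R : realType}.

Definition mutually_independent d d' (Psi : measurableType d)
    (E : measurableType d') (P : probability Psi R) n
    (X : 'I_n -> {RV P >-> E}) : Prop :=
  forall (J : {set 'I_n}) (A : 'I_n -> set E),
    (forall i, measurable (A i)) ->
    P (\bigcap_(i in [set` J]) (X i @^-1` A i)) =
    (\prod_(i in J) P (X i @^-1` A i))%E.

Definition iid d d' (Psi : measurableType d) (E : measurableType d')
    (P : probability Psi R) n (X : 'I_n -> {RV P >-> E})
    (mu : probability E R) : Prop :=
  (forall i A, measurable A -> distribution P (X i) A = mu A) /\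
  mutually_independent X.

(* Disintegration of [mu] along the multifunction sending [x] to the set of
   those [i] with [x \in B i], with respect to the uniform measure on ['I_n]. *)
Definition has_disintegration d (E : measurableType d) (mu : probability E R)
    n (B : 'I_n -> set E) : Prop :=
  exists mu_ : 'I_n -> probability E R,
    (forall i, mu_ i (B i) = 1%E) /\
    (forall A, measurable A ->
      mu A = ((n%:R^-1)%:E * \sum_(i < n) mu_ i A)%E).

Definition disintegrable (T : polishMetricType R)
    (mu : probability (borel T) R) (n : nat) (eps r : R) : Prop :=
  forall (d : measure_display) (Psi : measurableType d)
    (P : probability Psi R) (X : 'I_n -> {RV P >-> borel T}),
    iid X mu ->
    exists Om : set Psi,
      [/\ measurable Om,
          ((1 - eps)%:E <= P Om)%E
        & forall w, Om w ->
            has_disintegration mu (fun i => metric_cball (X i w : T) r)].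

End disintegrable.

Definition unit_interval (R : realType) : Type := set_type `[(0 : R), 1].

Section unit_interval.
Context {R : realType}.

Let zero_in01 : (0 : R) \in (`[0, 1]%classic : set R).
Proof. by rewrite inE /= in_itv /= lexx ler01. Qed.

HB.instance Definition _ := Choice.on (unit_interval R).

HB.instance Definition _ := isPointed.Build (unit_interval R)
  (exist _ 0 zero_in01).

HB.instance Definition _ :=
  PseudoMetric.copy (unit_interval R) (set_type `[(0 : R), 1]).

Let dist01 (x y : unit_interval R) : R := `|val x - val y|.

Let dist01_ge0 x y : 0 <= dist01 x y. Proof. exact: normr_ge0. Qed.

Let dist01_positivity x y : dist01 x y = 0 -> x = y.
Proof. by move/normr0_eq0/subr0_eq/val_inj. Qed.

Let ball_dist01 (x : unit_interval R) e : ball x e = [set y | dist01 x y < e].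
Proof. by []. Qed.

HB.instance Definition _ := PseudoMetric_isMetric.Build R (unit_interval R)
  dist01_ge0 dist01_positivity ball_dist01.

Lemma open_unit_intervalP (A : set (unit_interval R)) :
  open A <-> forall x, A x ->
    exists2 e : R, 0 < e & [set y : unit_interval R | `|val x - val y| < e] `<=` A.
Proof.
rewrite openE; split => AA x /AA.
  by rewrite /interior -nbhs_ballE => -[e /= e0 xeA]; exists e.
by move=> [e e0 xeA]; rewrite /interior -nbhs_ballE; exists e.
Qed.

Lemma unit_interval_ge0_le1 (x : unit_interval R) : 0 <= val x <= 1.
Proof. by have := valP x; rewrite inE /= in_itv. Qed.

Lemma unit_interval_separable : separable (unit_interval R).
Proof.
pose D : set (unit_interval R) :=
  range (fun q : rat => insubd (point : unit_interval R) (ratr q)).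
exists D; first exact: card_le_trans (card_image_le _ _) (countableP _).
move=> O [x Ox] /open_unit_intervalP /(_ _ Ox) [e e0 xeO].
pose t : R := val x.
have [t0 t1] : 0 <= t /\ t <= 1 by exact/andP/unit_interval_ge0_le1.
have : Num.max 0 (t - e) < Num.min 1 (t + e).
  by rewrite lt_min !gt_max ltr01 /=; apply/and3P; split; lra.
move=> /rat_in_itvoo[q]; rewrite in_itv /= gt_max lt_min.
move=> /andP[/andP[q0 tq] /andP[q1 qt]].
have q01 : ratr q \in (`[0, 1]%classic : set R).
  by rewrite inE /= in_itv /= !ltW.
exists (insubd (point : unit_interval R) (ratr q)); split; last by exists q.
apply: xeO => /=; rewrite val_insubd q01 -/t ltr_norml.
by apply/andP; split; lra.
Qed.

Lemma unit_interval_completely_metrizable :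
  completely_metrizable R (unit_interval R).
Proof.
exists dist01; split.
- by move=> x y; split => [/dist01_positivity//|->]; rewrite /dist01 subrr normr0.
- by move=> x y; rewrite /dist01 distrC.
- by move=> x y z; exact: ler_distD.
- exact: open_unit_intervalP.
- move=> u cu; pose v n : R := val (u n).
  have cv : cvgn v.
    apply/cauchy_cvgP/cauchy_exP => e e0; have [N uN] := cu e e0.
    by exists (v N); exists N => // m /= Nm; exact: uN.
  have v01 n : 0 <= v n <= 1 := unit_interval_ge0_le1 (u n).
  have l01 : limn v \in (`[0, 1]%classic : set R).
    rewrite inE /= in_itv /=; apply/andP; split.
      by apply: limr_ge => //; apply: nearW => n; case/andP: (v01 n).
    by apply: limr_le => //; apply: nearW => n; case/andP: (v01 n).
  exists (exist _ (limn v) l01 : unit_interval R) => e e0.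
  move/cvgrPdist_lt: cv => /(_ e e0) [N _ vN].
  by exists N => m Nm; rewrite /dist01 distrC; exact: vN.
Qed.

HB.instance Definition _ := isPolish.Build R (unit_interval R)
  unit_interval_separable unit_interval_completely_metrizable.

End unit_interval.

(* Only the values of [f] on [[0, 1]] matter. *)
Definition has_density (R : realType)
    (mu : probability (borel (unit_interval R)) R) (f : R -> R) : Prop :=
  measurable_fun (`[0, 1]%classic : set R) f /\
  forall A : set (borel (unit_interval R)), measurable A ->
    mu A = (\int[lebesgue_measure]_(x in [set val y | y in A]) (f x)%:E)%E.

Definition disintegration_radius (R : realType) (c alpha : R) (n : nat) : R :=
  4 * c^-1 * Num.sqrt ((2 + alpha) * (ln n%:R / n%:R)).

(* Main.v *)
Require Import Defs.
From mathcomp Require Import all_boot all_order all_algebra.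
From mathcomp Require Import all_classical all_reals all_analysis.
From mathcomp Require Import ring lra.

Import measurable_realfun.
Import Order.TTheory GRing.Theory Num.Theory.
Import numFieldTopology.Exports numFieldNormedType.Exports.
Local Open Scope classical_set_scope.
Local Open Scope ring_scope.

(** Let [F] be the distribution function of [mu] and [y k] its [k/n]-quantile.
    The cells [(y k, y k.+1]] all have mass [1/n], so [mu] is the average of its
    normalised restrictions to the cells.  Give to the sample point of rank [k]
    (the number of sample points before it, ties broken by the index) the
    restriction to the cell number [k].  It remains to see that, with high
    probability, every cell lies in the ball around its sample point.

    Let [t > 0] and suppose that, for each [k], the number of sample points that
    are at most [y k] differs from its mean [k] by less than [n * t].  If
    [y m] is the first quantile not below the point [x] of rank [k], then [m]
    and [k] differ by at most about [n * t], so that [F x] and the values of [F]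
    on the cell [k] differ by at most [t + 1/n]
    ([sample_near_quantile_cell]).  Since the density is at least [c], [F] grows
    at rate at least [c], and points of the cell are within [(t + 1/n) / c] of
    [x].  With [s] the square root of [(2 + alpha) ln n / n], the choice
    [t = 3 s] makes this at most [4 s / c], the prescribed radius, once
    [1/n <= s].

    Each of the [n + 1] counts is a sum of independent Bernoulli variables.
    Chernoff's method ([iid_count_tail]) bounds the probability of a deviation
    [n * t] by [2 exp (- n t^2 / 8)], which for [t = 3 s] is at most
    [2 n^-(2 + alpha)]; the union bound then loses only a factor of order [n],
    leaving at most [n^-alpha] ([radius_asymptotics]).  The upper bound [C] on
    the density serves to make [F] continuous, so that the quantiles exist. *)

(** * Concentration of the number of sample points in a set *)

(** This is weaker than Hoeffding's bound [l^2 / 8] in place of [2 l^2], but it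
    follows from [exp l <= 1 + l + 2 l^2], a consequence of
    [exp l <= 1 / (1 - l)]: comparing these two upper bounds is what needs
    [l <= 1/2]. *)
Lemma bernoulli_mgf_le (R : realType) (p l : R) :
  0 <= p <= 1 -> 0 <= l <= 2^-1 ->
  expR l * p + (1 - p) <= expR (l * p + 2 * l ^+ 2).
Proof.
move=> p01 l01; have el : expR l <= 1 + l + 2 * l ^+ 2.
  have := expR_ge1Dx (- l); rewrite expRN => h.
  rewrite -[leLHS]invrK invf_ple ?posrE ?invr_gt0 ?expR_gt0 //; last by nra.
  apply: le_trans h.
  by rewrite -div1r ler_pdivrMr; nra.
apply: le_trans (expR_ge1Dx _); nra.
Qed.

Lemma measure_bigU_le {d} {T : measurableType d} {R : realType} {I : finType}
    (P : {measure set T -> \bar R}) (Q : pred I) (B : I -> set T) :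
  (forall i, measurable (B i)) ->
  (P (\bigcup_(i in [set` Q]) B i) <= \sum_(i | Q i) P (B i))%E.
Proof.
move=> mB; rewrite bigcup_pred.
elim: (index_enum I) => [|i s IH]; first by rewrite !big_nil measure0.
rewrite !big_cons; rewrite -[i \in Q]/(Q i); case: ifP => // _.
by apply: le_trans (measureU2 _ _ _) _ => //;
  [exact: bigsetU_measurable|rewrite leeD2l].
Qed.

Definition hits {n} {T : Type} (A : set T) (x : 'I_n -> T) : {set 'I_n} :=
  [set i | x i \in A]%SET.

Section count_tail.
Context {R : realType} {d d' : measure_display} {Psi : measurableType d}
  {E : measurableType d'} {P : probability Psi R} {n : nat}
  {X : 'I_n -> {RV P >-> E}} {mu : probability E R}.
Hypothesis iidX : iid X mu.

Let hits_are (A : set E) (S : {set 'I_n}) : set Psi :=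
  [set w | hits A (X ^~ w) = S].

Let side (A : set E) (S : {set 'I_n}) i := if i \in S then A else ~` A.

Let hits_areE A S :
  hits_are A S = \bigcap_(i in [set` [set: 'I_n]%SET]) (X i @^-1` side A S i).
Proof.
apply/seteqP; split=> w /=.
  move=> <- i _; rewrite /side /hits inE /=; case: ifPn.
    by rewrite inE.
  by rewrite notin_setE.
move=> h; apply/setP => i; rewrite inE.
have := h i; rewrite /side /= inE => /(_ isT).
by case: (i \in S) => /= ?; [apply/mem_set|apply/memNset].
Qed.

Let measurable_side A S i : measurable A -> measurable (side A S i).
Proof. by move=> mA; rewrite /side; case: ifP => // _; exact: measurableC. Qed.

Let measurable_hits_are A S : measurable A -> measurable (hits_are A S).
Proof.
move=> mA; rewrite hits_areE; apply: fin_bigcap_measurable => // i _.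
rewrite -[X in measurable X]setTI; apply: measurable_funP => //.
exact: measurable_side.
Qed.

Let prob_hits_are A S : measurable A ->
  P (hits_are A S) =
  (\prod_(i < n) if i \in S then fine (mu A) else 1 - fine (mu A))%:E.
Proof.
move=> mA; rewrite hits_areE iidX.2; last by move=> i; exact: measurable_side.
rewrite -prodEFin big_mkcond/=; apply: eq_bigr => i _; rewrite inE.
have /(_ i) := iidX.1 => /(_ _ (measurable_side A S i mA)).
rewrite /distribution /pushforward => ->; rewrite /side; case: ifP => _.
  by rewrite fineK ?fin_num_measure.
by rewrite probability_setC// EFinB fineK ?fin_num_measure.
Qed.

Definition hits_ge (A : set E) (a : R) : set Psi :=
  [set w | a <= #|hits A (X ^~ w)|%:R].

Let hits_geE A a : hits_ge A a =
  \bigcup_(S in [set` [pred S : {set 'I_n} | a <= #|S|%:R]]) hits_are A S.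
Proof.
apply/seteqP; split=> w /=; first by exists (hits A (X ^~ w)).
by case=> S /= aS; rewrite /hits_are/= /hits_ge/= => ->.
Qed.

Lemma measurable_hits_ge A a : measurable A -> measurable (hits_ge A a).
Proof.
move=> mA; rewrite hits_geE; apply: fin_bigcup_measurable => // S _.
exact: measurable_hits_are.
Qed.

(** Chernoff's method, carried out on finite sums instead of expectations: the
    event is the disjoint union, over large enough [S], of the events that
    exactly the indices in [S] hit [A].  Each has a product probability by
    independence; weighting it by [exp (l * (#|S| - a)) >= 1] and summing over
    all [S] gives, by distributivity, the [n]-th power of the moment generating
    function of a Bernoulli variable. *)
Lemma iid_count_upper_tail A (t : R) : measurable A -> 0 <= t <= 2 ->
  (P (hits_ge A (n%:R * (fine (mu A) + t))) <=
     (expR (- (n%:R * t ^+ 2 / 8)))%:E)%E.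
Proof.
move=> mA t02; set p := fine (mu A); set a := n%:R * _.
have p01 : 0 <= p <= 1.
  by rewrite -!lee_fin /p fineK ?fin_num_measure// measure_ge0 probability_le1.
(* The minimiser of the exponent [2 * l ^+ 2 - l * t]. *)
pose l := t / 4.
have l01 : 0 <= l <= 2^-1 by rewrite /l; lra.
rewrite hits_geE; apply: le_trans (measure_bigU_le _ _ _ _) _.
  by move=> S; exact: measurable_hits_are.
rewrite (eq_bigr _ (fun S _ => prob_hits_are A S mA)).
rewrite sumEFin lee_fin -/p.
pose w (S : {set 'I_n}) : R :=
  \prod_(i < n) if i \in S then expR l * p else 1 - p.
have wE S : w S = expR (l * #|S|%:R) *
    \prod_(i < n) if i \in S then p else 1 - p.
  rewrite expRM_natr -prodr_const big_mkcond -big_split/=.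
  by apply: eq_bigr => i _; case: ifP => _; rewrite ?mul1r.
have w0 S : 0 <= \prod_(i < n) if i \in S then p else 1 - p.
  by apply: prodr_ge0 => i _; case: ifP => _; lra.
apply: (@le_trans _ _ (\sum_S expR (- (l * a)) * w S)).
  rewrite big_mkcond/=; apply: ler_sum => S _; rewrite wE mulrA -expRD.
  case: ifP => [aS|_]; last by rewrite mulr_ge0 ?expR_ge0.
  rewrite ler_peMl// -[leLHS]expR0 ler_expR addrC -mulrBr mulr_ge0 ?subr_ge0//.
  by case/andP: l01.
rewrite -mulr_sumr.
have <- : (expR l * p + (1 - p)) ^+ n = \sum_S w S.
  by rewrite -[X in _ ^+ X]card_ord -prodr_const bigA_distr.
apply: (@le_trans _ _ (expR (- (l * a)) * expR (l * p + 2 * l ^+ 2) ^+ n)).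
  rewrite ler_wpM2l ?expR_ge0// lerXn2r ?nnegrE ?expR_ge0//.
    by rewrite addr_ge0 ?mulr_ge0 ?expR_ge0; lra.
  exact: bernoulli_mgf_le.
rewrite -expRM_natl -expRD ler_expR /a /l.
lra.
Qed.

Definition hits_dev (A : set E) (t : R) : set Psi :=
  [set w | n%:R * t <= `|#|hits A (X ^~ w)|%:R - n%:R * fine (mu A)|].

(* A lower deviation for [A] is an upper deviation for its complement. *)
Let hits_devE A t : measurable A -> hits_dev A t =
  hits_ge A (n%:R * (fine (mu A) + t)) `|`
  hits_ge (~` A) (n%:R * (fine (mu (~` A)) + t)).
Proof.
move=> mA; have -> : fine (mu (~` A)) = 1 - fine (mu A).
  by rewrite probability_setC// fineB// fin_num_measure.
have hC w : #|hits (~` A) (X ^~ w)|%:R = n%:R - #|hits A (X ^~ w)|%:R :> R.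
  have -> : hits (~` A) (X ^~ w) = (~: hits A (X ^~ w))%SET.
    by apply/setP => i; rewrite !inE in_setC.
  have : #|hits A (X ^~ w)|%:R + #|~: hits A (X ^~ w)|%:R = n%:R :> R.
    by rewrite -natrD cardsC card_ord.
  by move=> <-; rewrite addrAC subrr add0r.
apply/seteqP; split=> w; rewrite /hits_dev /hits_ge /= hC !mulrDr mulrN mulr1.
  by rewrite ler_normr => /orP[h|h]; [left|right]; lra.
by rewrite ler_normr; case=> h; apply/orP; [left|right]; lra.
Qed.

Lemma measurable_hits_dev A t : measurable A -> measurable (hits_dev A t).
Proof.
by move=> mA; rewrite hits_devE//; apply: measurableU;
  apply: measurable_hits_ge => //; exact: measurableC.
Qed.

Lemma iid_count_tail A (t : R) : measurable A -> 0 <= t <= 2 ->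
  (P (hits_dev A t) <= (2 * expR (- (n%:R * t ^+ 2 / 8)))%:E)%E.
Proof.
move=> mA t02; have mAC := measurableC mA.
rewrite hits_devE//; set e := expR _; have -> : 2 * e = e + e by ring.
rewrite EFinD.
apply: le_trans (measureU2 _ _ _) _; [exact: measurable_hits_ge..|].
by apply: leeD; exact: iid_count_upper_tail.
Qed.

End count_tail.

(** * Ranks of the sample points and quantiles *)

Section rank.
Context {R : realType} {n : nat} (x : 'I_n -> R).

(** The lexicographic order on pairs (value, index): it makes ranks distinct
    even when sample points coincide. *)
Definition precedes (i j : 'I_n) : bool :=
  (x i < x j) || (x i == x j) && (i < j)%N.

Definition rank (j : 'I_n) : nat := #|[set i | precedes i j]%SET|.

Definition count_le (a : R) : nat := #|[set i | x i <= a]%SET|.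

Let precedes_irr i : precedes i i = false.
Proof. by rewrite /precedes ltxx ltnn andbF. Qed.

Let precedes_trans : transitive precedes.
Proof.
rewrite /precedes => j i k /orP[ij|/andP[/eqP-> ij]] /orP[jk|/andP[/eqP<- jk]].
- by rewrite (lt_trans ij jk).
- by rewrite ij.
- by rewrite jk.
- by rewrite eqxx (ltn_trans ij jk) orbT.
Qed.

Let precedes_total i j : i != j -> precedes i j || precedes j i.
Proof.
move=> ij; rewrite /precedes; case: (ltgtP (x i) (x j)) => //= _.
by rewrite -neq_ltn.
Qed.

Let rank_homo i j : precedes i j -> (rank i < rank j)%N.
Proof.
move=> ij; apply/proper_card/properP; split.
  by apply/fintype.subsetP => k; rewrite !inE => /precedes_trans; apply.
by exists i; rewrite !inE ?precedes_irr.
Qed.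

Lemma rank_lt j : (rank j < n)%N.
Proof.
rewrite -[ltnRHS]card_ord -cardsT; apply/proper_card/properP; split.
  exact: finset.subsetT.
by exists j; rewrite !inE ?precedes_irr.
Qed.

Lemma rank_inj : injective rank.
Proof.
move=> i j rij; apply/eqP; apply: contraT => /precedes_total.
by move=> /orP[] /rank_homo; rewrite rij ltnn.
Qed.

Lemma count_le_rank j a : a < x j -> (count_le a <= rank j)%N.
Proof.
move=> aj; apply/subset_leq_card/fintype.subsetP => i.
rewrite !inE /precedes => ia.
by rewrite (le_lt_trans ia aj).
Qed.

Lemma rank_lt_count_le j a : x j <= a -> (rank j < count_le a)%N.
Proof.
move=> ja; apply/proper_card/properP; split.
  apply/fintype.subsetP => i; rewrite !inE => /orP[ij|/andP[/eqP-> _]//].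
  exact: le_trans (ltW ij) ja.
by exists j; rewrite !inE ?precedes_irr.
Qed.

End rank.

Section near_quantile.
Context {R : realType} {n : nat} (x : 'I_n -> R) (F : R -> R) (c t : R)
  (y : nat -> R).

(** If the counts at the quantiles are all within [n * t] of their means, then
    [F] differs by at most [t + 1/n] between a sample point and the cell that
    bears its rank, and the growth of [F] turns this into a distance. *)
Lemma sample_near_quantile_cell :
  (forall a b, 0 <= a -> a <= b -> b <= 1 -> c * (b - a) <= F b - F a) ->
  0 < c ->
  (forall k, (k <= n)%N -> 0 <= y k <= 1 /\ n%:R * F (y k) = k%:R) ->
  y 0%N = 0 -> y n = 1 ->
  (forall i, 0 <= x i <= 1) ->
  (forall k, (k <= n)%N -> `|(count_le x (y k))%:R - k%:R| < n%:R * t) ->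
  forall i z, y (rank x i) < z -> z <= y (rank x i).+1 ->
    n%:R * (c * `|x i - z|) <= n%:R * t + 1.
Proof.
move=> cF c0 yF y0 yn x01 N i z; set k := rank x i => kz zk.
have kn : (k < n)%N := rank_lt x i.
have /andP[xi0 xi1] := x01 i.
have nF a b : 0 <= a -> a <= b -> b <= 1 ->
    n%:R * (c * (b - a)) <= n%:R * F b - n%:R * F a.
  by move=> *; rewrite -mulrBr ler_wpM2l// cF.
have mF a b : 0 <= a -> a <= b -> b <= 1 -> n%:R * F a <= n%:R * F b.
  move=> a0 ab b1; have := nF a b a0 ab b1; apply: contraTT.
  rewrite -!ltNge -subr_lt0 => h; apply: (lt_le_trans h).
  by rewrite !mulr_ge0 ?(ltW c0)// subr_ge0.
have [[/andP[yk0 _] Fyk] [/andP[_ yk1] Fyk1]] := (yF _ (ltnW kn), yF _ kn).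
have z0 : 0 <= z by rewrite ltW// (le_lt_trans yk0).
have z1 : z <= 1 := le_trans zk yk1.
have Fz_ge : k%:R <= n%:R * F z by rewrite -Fyk; apply: mF => //; exact: ltW.
have Fz_le : n%:R * F z <= k%:R + 1 by rewrite natr1 -Fyk1; exact: mF.
(* The number of the first quantile that is not below [x i] stands for
   [n%:R * F (x i)] up to an error of 1. *)
have ex_m : exists m, x i <= y m by exists n; rewrite yn.
case: (ex_minnP ex_m) => m xm m_min.
have mn : (m <= n)%N by apply: m_min; rewrite yn.
have y_pred : (0 < m)%N -> y m.-1 < x i.
  move=> m0; rewrite ltNge; apply/negP => /m_min.
  by rewrite leqNgt prednK// leqnn.
have [/andP[ym0 ym1] Fym] := yF _ mn.
have Fx_le : n%:R * F (x i) <= m%:R by rewrite -Fym mF.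
(* Sample points at most [y m.-1] precede [x i], so they are at most [k]. *)
have m_le : m%:R <= k%:R + n%:R * t + 1.
  case: (posnP m) => [->|m0].
    by have := le_lt_trans (normr_ge0 _) (N _ mn); have := ler0n R k; lra.
  have ylt := y_pred m0.
  have m1n : (m.-1 <= n)%N := leq_trans (leq_pred m) mn.
  have := N _ m1n; rewrite ltr_norml => /andP[+ _].
  have := count_le_rank x i _ ylt; rewrite -(ler_nat R) -/k.
  rewrite -[in m%:R](prednK m0) -natr1; lra.
have Fx_ge : m%:R - 1 <= n%:R * F (x i).
  case: (posnP m) => [->|m0].
    have := mF 0 (x i) (lexx _) xi0 xi1.
    by have [_ +] := yF _ (leq0n n); rewrite y0 => ->; lra.
  have ylt := y_pred m0.
  have m1n : (m.-1 <= n)%N := leq_trans (leq_pred m) mn.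
  have [/andP[? _] +] := yF _ m1n.
  have := mF (y m.-1) (x i); rewrite -[in m%:R](prednK m0) -natr1 => h.
  rewrite addrK => <-; apply: h => //; exact: ltW.
(* Sample points at most [y m] include [x i] and its [k] predecessors. *)
have m_ge : k%:R + 1 < m%:R + n%:R * t.
  have := N _ mn; rewrite ltr_norml => /andP[_].
  have := rank_lt_count_le x i _ xm; rewrite -(ler_nat R) -/k -natr1; lra.
case: (leP z (x i)) => [zx|xz].
  rewrite ger0_norm ?subr_ge0//.
  have := nF _ _ z0 zx xi1; lra.
rewrite ltr0_norm ?subr_lt0// opprB.
have := nF _ _ xi0 (ltW xz) z1; lra.
Qed.

End near_quantile.

(** * The distribution function of a measure with bounded density *)

Section cdf01.
Context {R : realType}.
Local Notation T := (unit_interval R).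

Definition below (a : R) : set (borel T) := [set z : T | val z <= a].

Lemma measurable_below a : measurable (below a).
Proof.
rewrite -[below a]setCK; apply: measurableC; apply: sub_sigma_algebra.
apply/open_unit_intervalP => z /negP; rewrite -ltNge => az.
exists (val z - a); first by rewrite subr_gt0.
move=> v /=; rewrite ltr_norml => /andP[_ h]; apply/negP; rewrite -ltNge.
by move: h; rewrite ltrD2l ltrN2.
Qed.

Definition oc (a b : R) : set (borel T) := below b `\` below a.

Lemma measurable_oc a b : measurable (oc a b).
Proof. by apply: measurableD; exact: measurable_below. Qed.

Context {mu : probability (borel T) R} {f : R -> R} {c C : R}.
Hypothesis f_density : has_density mu f.
Hypothesis c_gt0 : 0 < c.
Hypothesis f_bounds : forall x : R, 0 <= x <= 1 -> c <= f x <= C.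

Definition cdf (a : R) : R := fine (mu (below a)).

Lemma mu_below a : mu (below a) = (cdf a)%:E.
Proof. rewrite fineK ?fin_num_measure//; exact: (measurable_below a). Qed.

Lemma mu_oc a b : a <= b -> mu (oc a b) = (cdf b - cdf a)%:E.
Proof.
move=> ab; have mb := measurable_below.
rewrite measureD//; last by rewrite ltey_eq fin_num_measure.
rewrite setIidr /= ?mu_below//; move=> z /= za; exact: le_trans za ab.
Qed.

Lemma val_oc a b : 0 <= a -> b <= 1 ->
  [set val z | z in oc a b] = `]a, b]%classic.
Proof.
move=> a0 b1; apply/seteqP; split=> u /=.
  by move=> [z [zb /negP]]; rewrite -ltNge => az <-; rewrite in_itv /= az.
rewrite in_itv /= => /andP[au ub].
have u01 : u \in (`[0, 1]%classic : set R) by rewrite inE /= in_itv /=; lra.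
by exists (exist _ u u01) => //; split => //=; apply/negP; rewrite -ltNge.
Qed.

Lemma cdf_increment (a b : R) : 0 <= a -> a <= b -> b <= 1 ->
  c * (b - a) <= cdf b - cdf a <= C * (b - a).
Proof.
move=> a0 ab b1.
have mf : measurable_fun (`]a, b]%classic : set R) (EFin \o f).
  apply/measurable_EFinP; apply: measurable_funS f_density.1 => //.
  by move=> x /=; rewrite !in_itv /=; lra.
have I r : (\int[lebesgue_measure]_(x in (`]a, b]%classic : set R)) r%:E =
    (r * (b - a))%:E)%E.
  rewrite integral_cst//= lebesgue_measure_itv/= lte_fin EFinM; case: ltP => //.
  by move=> ba; have -> : b - a = 0 by lra.
have fb x : `]a, b]%classic x -> c <= f x <= C.
  by rewrite /= in_itv /= => ?; apply: f_bounds; lra.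
rewrite -!lee_fin -mu_oc// (f_density.2 _ (measurable_oc a b)) val_oc// -!I.
apply/andP; split; apply: ge0_le_integral => //.
- by move=> x _; rewrite lee_fin ltW.
- by move=> x /fb; rewrite lee_fin => /andP[+ _].
- by move=> x /fb /andP[cf _]; rewrite lee_fin (le_trans (ltW c_gt0) cf).
- by move=> x /fb /andP[_ fC]; rewrite lee_fin.
Qed.

Lemma cdf1 : cdf 1 = 1.
Proof.
rewrite /cdf; have -> : below 1 = setT; last by rewrite probability_setT.
by apply/seteqP; split => // z _ /=; case/andP: (unit_interval_ge0_le1 z).
Qed.

Lemma cdf0 : cdf 0 = 0.
Proof.
rewrite /cdf f_density.2; last exact: measurable_below.
suff -> : [set val y | y in below 0] = [set (0 : R)].
  by rewrite integral_set1.
apply/seteqP; split=> u /=.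
  move=> [z z0 <-]; apply/eqP; rewrite eq_le z0.
  by case/andP: (unit_interval_ge0_le1 z).
move=> ->; exists (point : T)  => //; exact: lexx.
Qed.

Lemma cdf_lipschitz (a b : R) : 0 <= a <= 1 -> 0 <= b <= 1 ->
  `|cdf a - cdf b| <= C * `|a - b|.
Proof.
wlog ab : a b / a <= b => [H a01 b01|/andP[a0 _] /andP[_ b1]].
  case: (leP a b) => ab; first exact: H.
  by rewrite distrC [`|a - b|]distrC H// ltW.
have /andP[h hC] := cdf_increment a b a0 ab b1.
rewrite distrC ger0_norm; last first.
  by apply: le_trans h; rewrite mulr_ge0 ?(ltW c_gt0) ?subr_ge0.
by rewrite distrC [`|b - a|]ger0_norm ?subr_ge0.
Qed.

(** The upper bound on the density makes [cdf] Lipschitz, hence continuous, so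
    that the intermediate value theorem applies. *)
Lemma quantile_exists v : 0 <= v <= 1 -> exists2 y, 0 <= y <= 1 & cdf y = v.
Proof.
move=> v01.
have C0 : 0 < C.
  have := f_bounds 0; rewrite lexx ler01 => /(_ isT)/andP[h].
  exact/lt_le_trans/(lt_le_trans c_gt0 h).
have cF : {within `[0, 1], continuous cdf}.
  apply/subspace_continuousP => x; rewrite /= in_itv /= => x01.
  apply/cvgrPdist_le => e e0; near=> z.
  have z01 : 0 <= (z : R) <= 1.
    by have : z \in `[0, 1] by (near: z; exact: withinT); rewrite in_itv.
  apply: le_trans (cdf_lipschitz _ _ x01 z01) _.
  rewrite mulrC -ler_pdivlMr//; near: z; apply: cvg_within.
  by apply: (@cvgr_dist_le _ _ _ (nbhs x) _ id x cvg_id); rewrite divr_gt0.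
have [||y] := @IVT _ cdf 0 1 v _ cF; first exact: ler01.
  by rewrite cdf0 cdf1 min_l ?max_r.
by rewrite in_itv; exists y.
Unshelve. all: by end_near.
Qed.

End cdf01.

(** * Disintegration along cells of equal mass *)

(** The components are the normalised restrictions of [mu] to the cells.  The
    cells need only be disjoint: having [n] times the mass [1/n], they cover
    the space up to a null set. *)
Lemma has_disintegration_cells {d} {E : measurableType d} {R : realType}
    (mu : probability E R) {n : nat} (B Q : 'I_n -> set E) :
  (0 < n)%N -> (forall i, measurable (Q i)) -> trivIset setT Q ->
  (forall i, mu (Q i) = (n%:R^-1)%:E) -> (forall i, Q i `<=` B i) ->
  has_disintegration mu B.
Proof.
move=> n0 mQ tQ muQ QB.
have nR : n%:R != 0 :> R by rewrite pnatr_eq0 -lt0n.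
pose mu_ i : probability E R := mnormalize (mrestr mu (mQ i)) mu.
have mu_E i A : mu_ i A = (mu (A `&` Q i) * n%:R%:E)%E.
  rewrite /mu_/= /mnormalize /= /mrestr setTI muQ eqe invr_eq0 (negbTE nR)/=.
  by rewrite invrK.
exists mu_; split=> [i|A mA].
  by rewrite mu_E setIidr// muQ -EFinM mulVf.
have mU : measurable (\bigcup_i Q i) by exact: fin_bigcup_measurable.
have sumQ D : measurable D ->
    mu (D `&` \bigcup_i Q i) = (\sum_(i < n) mu (D `&` Q i))%E.
  move=> mD; rewrite setI_bigcupr measure_fin_bigcup//.
  - rewrite [RHS]fsbig_seq ?index_enum_uniq//; apply: eq_fsbigl.
    by apply/seteqP; split => // i _; rewrite /= mem_index_enum.
  - exact: finite_finset.
  - exact: trivIset_setIl.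
  - by move=> i _; exact: measurableI.
have muU : mu (\bigcup_i Q i) = 1%E.
  rewrite -[\bigcup_i Q i]setTI sumQ//.
  under eq_bigr do rewrite setTI muQ.
  by rewrite sumEFin sumr_const card_ord -[_ *+ _]mulr_natr mulVf.
have muC : mu (~` \bigcup_i Q i) = 0%E.
  by rewrite probability_setC// muU subee.
have muD : mu (A `\` \bigcup_i Q i) = 0%E.
  have mAU := measurableD mA mU.
  by apply: (subset_measure0 mAU (measurableC mU) _ muC) => x [].
rewrite [LHS](measureDI mu mA mU)/= muD add0e sumQ//.
under [in RHS]eq_bigr do rewrite mu_E.
rewrite -ge0_sume_distrl// muleCA -EFinM.
by rewrite mulVf// mule1.
Qed.

(** * The choice of the radius *)

(** With deviation [t = 3 s], the last three facts say that the Chernoff bound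
    applies to [t], that [n * t + 1 <= 4 * (n * s)], and that the union bound
    over [n + 1] two-sided deviations stays below [n^-alpha]. *)
Lemma radius_asymptotics (R : realType) (alpha : R) : 0 < alpha ->
  exists n0 : nat, forall n : nat, (n0 <= n)%N ->
    let s := Num.sqrt ((2 + alpha) * (ln n%:R / n%:R)) in
    [/\ (0 < n)%N, 0 < 3 * s <= 2, 1 <= n%:R * s &
      (n.+1%:R * (2 * expR (- (n%:R * (3 * s) ^+ 2 / 8)))) <=
        n%:R `^ (- alpha)].
Proof.
move=> a0; pose M := (9 * (2 + alpha)) ^+ 2.
have M0 : 0 <= M by exact: sqr_ge0.
(* As [ln n <= 2 sqrt n], the condition [M <= n] gives [(3 s)^2 <= 2]. *)
exists (maxn 3 (Num.truncn M).+1) => n; rewrite geq_max => /andP[n3 nM] s.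
have nM' : M <= n%:R.
  apply: ltW (lt_le_trans (truncnS_gt M) _).
  by rewrite ler_nat.
have n3' : 3 <= n%:R :> R by rewrite (ler_nat R 3).
have n0' : 0 < n%:R :> R by lra.
set L := ln (n%:R : R).
have L_ge : 2 / 3 <= L.
  have := @le_ln1Dx R (n%:R^-1 - 1).
  rewrite addrCA subrr addr0 lnV ?posrE// -/L => h.
  have : n%:R^-1 <= 3^-1 :> R by rewrite lef_pV2 ?posrE//; lra.
  have : 0 < n%:R^-1 :> R by rewrite invr_gt0.
  move: h; lra.
have L_le : L <= 2 * Num.sqrt n%:R.
  have -> : Num.sqrt n%:R = expR (L / 2) :> R.
    have -> : n%:R = expR (L / 2) ^+ 2 :> R.
      by rewrite -expRM_natl mulrC divfK// lnK ?posrE.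
    by rewrite sqrtr_sqr ger0_norm ?expR_ge0.
  by have := expR_ge1Dx (L / 2); lra.
have s2E : s ^+ 2 = (2 + alpha) * (L / n%:R).
  by rewrite /s -/L sqr_sqrtr// mulr_ge0 ?divr_ge0//; lra.
have ns2 : n%:R * s ^+ 2 = (2 + alpha) * L.
  by rewrite s2E mulrCA [n%:R * _]mulrC divfK ?gt_eqF.
have s0 : 0 <= s by exact: sqrtr_ge0.
have ns1 : 1 <= n%:R * s.
  have : 1 <= (n%:R * s) ^+ 2.
    have : 1 <= (2 + alpha) * L by nra.
    by rewrite exprMn expr2 -mulrA ns2; nra.
  by rewrite -{1}(expr1n _ 2) ler_sqr ?nnegrE// mulr_ge0// ltW.
split=> //.
- by case: n n3 {nM n0' n3' nM' L L_ge L_le s2E ns2 ns1 s s0}.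
- apply/andP; split; first by nra.
  pose q : R := Num.sqrt n%:R.
  have q0 : 0 <= q by exact: sqrtr_ge0.
  have q2 : q ^+ 2 = n%:R by rewrite sqr_sqrtr// ltW.
  have q_ge : 9 * (2 + alpha) <= q.
    rewrite -(@ler_pXn2r _ 2) ?nnegrE ?q2//; lra.
  have : n%:R * (3 * s) ^+ 2 <= n%:R * 2 ^+ 2 by rewrite -/q in L_le; nra.
  by rewrite ler_pM2l// ler_pXn2r ?nnegrE ?mulr_ge0.
rewrite /powR gt_eqF// -/L.
have -> : n%:R * (3 * s) ^+ 2 / 8 = 9 / 8 * ((2 + alpha) * L).
  by rewrite -ns2; ring.
have en : expR L = n%:R by rewrite lnK ?posrE.
(* The factor [n ^- 2] absorbs the [2 * n.+1] events of the union bound. *)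
have h : expR (- (9 / 8 * ((2 + alpha) * L))) <= expR (- alpha * L) / n%:R ^+ 2.
  rewrite -en -expRM_natl -expRN -expRD ler_expR; nra.
apply: le_trans (ler_wpM2l _ (ler_wpM2l _ h)) _ => //.
rewrite -natr1 mulrA mulrCA -ler_pdivlMl ?expR_gt0//.
rewrite mulVf ?gt_eqF ?expR_gt0// ler_pdivrMr ?exprn_gt0//; nra.
Qed.

(** * Disintegrability of the unit interval *)

Theorem theorem4p5 (R : realType) (c C alpha : R)
    (c_gt0 : 0 < c) (c_le_C : c <= C) (alpha_gt0 : 0 < alpha) :
  exists n0 : nat, (0 < n0)%N /\
    forall (mu : probability (borel (unit_interval R)) R) (f : R -> R),
      has_density mu f ->
      (forall x : R, 0 <= x <= 1 -> c <= f x <= C) ->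
      forall n : nat, (n0 <= n)%N ->
        disintegrable mu n (n%:R `^ (- alpha)) 
          (disintegration_radius c alpha n).
Proof.
have [n0 n0P] := radius_asymptotics R alpha alpha_gt0.
exists n0.+1; split=> // mu f f_density f_bounds n /ltnW /n0P.
rewrite /disintegration_radius; set s := Num.sqrt _.
move=> [n_gt0 t_bounds ns_ge1 tail_le] d Psi P X iidX.
set t := 3 * s in t_bounds tail_le.
have nR_gt0 : 0 < n%:R :> R by rewrite ltr0n.
have cF := fun a b a0 ab b1 =>
  proj1 (andP (cdf_increment f_density c_gt0 f_bounds a b a0 ab b1)).
have y_ex k : exists y : R,
    (k <= n)%N -> 0 <= y <= 1 /\ cdf (mu := mu) y = k%:R / n%:R.
  case: (leqP k n) => kn; last by exists 0.
  have [|y y01 yk] := quantile_exists f_density c_gt0 f_bounds (k%:R / n%:R).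
    by rewrite divr_ge0//= ler_pdivrMr// mul1r ler_nat.
  by exists y.
have [y yP] := choice y_ex.
have y0 : y 0%N = 0.
  have [/andP[y_ge y_le] Fy] := yP 0%N (leq0n n).
  have := cF 0 _ (lexx 0) y_ge y_le; rewrite Fy (cdf0 f_density) mul0r !subr0.
  by rewrite pmulr_rle0// => ?; apply/eqP; rewrite eq_le y_ge andbT.
have yn : y n = 1.
  have [/andP[y_ge y_le] Fy] := yP n (leqnn n).
  have := cF _ 1 y_ge y_le (lexx 1); rewrite Fy cdf1 divff ?gt_eqF// subrr.
  by rewrite pmulr_rle0// subr_le0 => ?; apply/eqP; rewrite eq_le y_le.
have yS k l : (k <= l)%N -> (l <= n)%N -> y k <= y l.
  move=> kl ln; rewrite leNgt; apply/negP => lt_y.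
  have [/andP[_ yk1] Fk] := yP _ (leq_trans kl ln).
  have [/andP[yl0 _] Fl] := yP _ ln.
  have := cF _ _ yl0 (ltW lt_y) yk1; rewrite leNgt => /negP; apply.
  apply: (@le_lt_trans _ _ 0); last by rewrite mulr_gt0 ?subr_gt0.
  by rewrite Fk Fl subr_le0 ler_pM2r ?invr_gt0// ler_nat.
(* Both extremes 0 and [n] are included: the quantile that brackets a sample
   point may be any of the [n.+1] ones. *)
pose Bad (k : 'I_n.+1) := hits_dev (X := X) (mu := mu) (below (y k)) t.
have mBad k : measurable (Bad k).
  by apply: measurable_hits_dev; exact: measurable_below.
have mBadU : measurable (\bigcup_(k in [set` predT]) Bad k).
  by apply: fin_bigcup_measurable.
exists (~` \bigcup_(k in [set` predT]) Bad k); split; first exact: measurableC.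
- rewrite probability_setC// EFinB leeB//.
  apply: le_trans (measure_bigU_le P predT Bad mBad) _.
  apply: (@le_trans _ _
      (\sum_(k < n.+1) (2 * expR (- (n%:R * t ^+ 2 / 8)))%:E)%E).
    apply: lee_sum => k _; apply: iid_count_tail => //.
      exact: measurable_below.
    by case/andP: t_bounds => /ltW -> ->.
  by rewrite sumEFin lee_fin sumr_const card_ord -[leLHS]mulr_natl.
move=> w good_w.
pose x i : R := val (X i w : unit_interval R).
have countE a : #|hits (below a) (X ^~ w)| = count_le x a.
  by apply: eq_card => i; rewrite !inE; apply/idP/idP => [/set_mem|/mem_set].
have x01 i : 0 <= x i <= 1 by exact: unit_interval_ge0_le1.
have count_close k : (k <= n)%N ->
    `|(count_le x (y k))%:R - k%:R| < n%:R * t.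
  move=> kn; rewrite ltNge; apply/negP => dev; apply: good_w.
  exists (Ordinal (kn : k < n.+1)%N) => //; rewrite /Bad /hits_dev /= countE.
  rewrite -[fine _]/(cdf (mu := mu) (y k)).
  by rewrite (yP k kn).2 [_ * (_ / _)]mulrC divfK ?gt_eqF.
apply: (@has_disintegration_cells _ _ _ _ _ _
  (fun i => oc (y (rank x i)) (y (rank x i).+1))) => //.
- by move=> i; exact: measurable_oc.
- apply/trivIsetP => i j _ _; wlog: i j / (rank x i <= rank x j)%N.
    by move=> H ij; case: (leqP (rank x i) (rank x j)) => [/H|/ltnW/H];
      [apply|rewrite setIC; apply; rewrite eq_sym].
  rewrite leq_eqVlt => /orP[/eqP/rank_inj ->|rij _]; first by rewrite eqxx.
  apply/seteqP; split=> // z [[/= zi _] [_ zj]]; apply: zj => /=.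
  by apply: le_trans zi _; apply: yS => //; exact: ltnW (rank_lt x j).
- move=> i; have kn := rank_lt x i.
  rewrite mu_oc ?yS// (yP _ (ltnW kn)).2 (yP _ kn).2 -mulrBl -natr1.
  by rewrite addrAC subrr add0r mul1r.
- move=> i z [/= z_le /negP]; rewrite -ltNge => z_gt.
  rewrite /metric_cball /=.
  have := @sample_near_quantile_cell _ _ x (cdf (mu := mu)) c t y cF c_gt0 _
    y0 yn x01 count_close i (val z) z_gt z_le.
  have yF k : (k <= n)%N -> 0 <= y k <= 1 /\ n%:R * cdf (mu := mu) (y k) = k%:R.
    by move=> /yP[? ->]; split; rewrite // mulrC divfK ?gt_eqF.
  move=> /(_ yF) h.
  (* The distance of the unit interval unfolds to that of the reals. *)
  change (`|x i - val z| <= 4 * c^-1 * s).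
  rewrite [4 * _]mulrC -mulrA -ler_pdivrMl ?invr_gt0// invrK.
  rewrite -(ler_pM2l nR_gt0); apply: le_trans h _.
  by rewrite /t; lra.
Qed.
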